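(* Let $\mathcal F=(\langle G_x:x\in I\rangle,\langle\varphi_{xy}:(x,y)\in\mathcal E\rangle,\langle C_{xyz}:(x,y,z)\in\mathcal E_3\rangle)$ be a semi-frame that satisfies the coset conditions. Then the algebra $\mathfrak C[\mathcal F]$ constructed from $\mathcal F$ is a complete and atomic measurable relation algebra with base set $U=\bigcup\{G_x:x\in I\}$ and unit $E=\bigcup\{G_x\times G_y:(x,y)\in\mathcal E\}$. The atoms of this algebra are the relations $R_{xy,\alpha}$ for $(x,y)\in\mathcal E$ and $\alpha<\kappa_{xy}$, the subidentity atoms are the relations $R_{xx,0}$ for $x\in I$, and the measure of $R_{xx,0}$ is the cardinality of the group $G_x$.
   Context: **Group triples.** Let $I$ be a set, $\mathcal E$ an equivalence relation on $I$, $\mathcal E_3=\{(x,y,z):(x,y),(y,z)\in\mathcal E\}$, and $\mathcal E_4=\{(x,y,z,w):(x,y),(x,z),(x,w)\in\mathcal E\}$. A group triple $\mathcal F=(G,\varphi,C)$ consists of pairwise disjoint groups $G_x$ ($x\in I$) with operation $\circ$ and identity $e_x$; for each $(x,y)\in\mathcal E$ an isomorphism $\varphi_{xy}:G_x/H_{xy}\to G_y/K_{xy}$, where $H_{xy}\trianglelefteq G_x$ and $K_{xy}\trianglelefteq G_y$ are determined by $\varphi_{xy}$; and for each $(x,y,z)\in\mathcal E_3$ a coset $C_{xyz}$ of the normal subgroup $H_{xy}\circ H_{xz}$ in $G_x$. For subsets $X,Y$ of a group, $X\circ Y=\{a\circ b:a\in X,b\in Y\}$ and $X^{-1}=\{a^{-1}:a\in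 X\}$. If $Q\subseteq G_x$ is a union of cosets of $H_{xy}$, then $\varphi_{xy}[Q]$ is the union of the sets $\varphi_{xy}(D)$ over cosets $D\subseteq Q$ of $H_{xy}$; $\varphi_{xy}^{-1}[Q]$ is defined similarly for unions $Q$ of cosets of $K_{xy}$. **Semi-frames.** $\mathcal F$ is a semi-frame if: (i) $\varphi_{xx}$ is the identity automorphism of $G_x/\{e_x\}$ (so $H_{xx}=K_{xx}=\{e_x\}$) for all $x\in I$; (ii) $\varphi_{yx}=\varphi_{xy}^{-1}$ for all $(x,y)\in\mathcal E$ (so $H_{yx}=K_{xy}$); (iii) $\varphi_{xy}[H_{xy}\circ H_{xz}]=K_{xy}\circ H_{yz}$ for all $(x,y,z)\in\mathcal E_3$; (iv) for all $(x,y,z)\in\mathcal E_3$ and all cosets $D$ of $H_{xy}\circ H_{xz}$, $\varphi_{yz}[\varphi_{xy}[D]]=\varphi_{xz}[C_{xyz}^{-1}\circ D\circ C_{xyz}]$. **Coset conditions.** (1) $C_{xyy}=H_{xy}$ for all $(x,y)\in\mathcal E$; (2) $\varphi_{xz}[C_{xyz}]=C_{zyx}^{-1}$ and (3) $\varphi_{xy}[C_{xyz}]=C_{yxz}^{-1}$ for all $(x,y,z)\in\mathcal E_3$; (4) $C_{xyz}\circ C_{xzw}=\varphi_{yx}[C_{yzw}\circ H_{yx}]\circ C_{xyw}$ for all $(x,y,z,w)\in\mathcal E_4$. **The algebra $\mathfrak C[\mathcal F]$.** For each $(x,y)\in\mathcal E$ fix an enumeration without repetitions $\langle H_{xy,\gamma}:\gamma<\kappa_{xy}\rangle$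 of the cosets of $H_{xy}$ in $G_x$ with $H_{xy,0}=H_{xy}$, and put $K_{xy,\gamma}=\varphi_{xy}(H_{xy,\gamma})$; the enumerations are chosen so that $\kappa_{yx}=\kappa_{xy}$ and $H_{yx,\gamma}=K_{xy,\gamma}$. For $\alpha<\kappa_{xy}$ let $R_{xy,\alpha}=\bigcup_{\gamma<\kappa_{xy}}H_{xy,\gamma}\times(K_{xy,\gamma}\circ K_{xy,\alpha})$. Let $A$ be the collection of all unions of sets of relations $R_{xy,\alpha}$ ($(x,y)\in\mathcal E$, $\alpha<\kappa_{xy}$). Define $\otimes$ on $A$ by $R_{xy,\alpha}\otimes R_{yz,\beta}=\bigcup\{R_{xz,\gamma}:H_{xz,\gamma}\subseteq\varphi_{xy}^{-1}[K_{xy,\alpha}\circ H_{yz,\beta}]\circ C_{xyz}\}$, $R_{xy,\alpha}\otimes R_{wz,\beta}=\varnothing$ if $y\ne w$, and complete distributivity over arbitrary unions. Then $\mathfrak C[\mathcal F]=\langle A,\cup,\sim,\otimes,{}^{-1},\mathrm{id}_U\rangle$, where $\sim$ is complement relative to $E$, ${}^{-1}$ is relational converse, and $\mathrm{id}_U$ is the identity relation on $U$. **Measurability.** Relation algebras are understood in Tarski's sense (operations $+,-,;,{}^{\smile},1\text{'}$). An element $f$ is functional if $f^{\smile};f\le 1\text{'}$. A subidentity atom $x$ (an atom $x\le 1\text{'}$) is measurable if $x;1;x$ is a sum of functional elements; its measure is the number of non-zero functional elements below $x;1;x$. A relation algebra is measurable if its identity element is a sum of measurable atoms. *)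

(* Defs.v *)
From HB Require Import structures.
From Stdlib Require Export RelationClasses.
From mathcomp Require Export all_boot all_order monoid.
From mathcomp Require Export classical_sets functions cardinality wochoice.

Set Implicit Arguments.
Unset Strict Implicit.
Unset Printing Implicit Defensive.

Local Open Scope classical_set_scope.
Local Open Scope group_scope.

Section Complexes.
Variable G : groupType.
Implicit Types X Y N : set G.

Definition setmulg X Y : set G := [set a * b | a in X & b in Y].
Definition setinvg X : set G := [set a^-1 | a in X].

Definition normal_subgroup N :=
  [/\ N 1, (forall a b, N a -> N b -> N (a * b^-1))
    & forall a b, N a -> N (b^-1 * a * b)].

Definition cosets N : set (set G) := [set setmulg [set a] N | a in setT].

End Complexes.

Notation "X \o* Y" := (setmulg X Y) (at level 40, left associativity).
Notation "X ^-1*" := (setinvg X) (at level 3, left associativity, format "X ^-1*").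

(* [f] restricts to an isomorphism from G / H to G' / K; the elements of the
   quotients are the cosets and their product is the complex product.  The
   values of [f] on sets that are not cosets of [H] are irrelevant. *)
Definition quotient_isomorphism (G G' : groupType) (H : set G) (K : set G')
    (f : set G -> set G') :=
  [/\ normal_subgroup H, normal_subgroup K, set_bij (cosets H) (cosets K) f
    & forall D D', cosets H D -> cosets H D' -> f (D \o* D') = f D \o* f D'].

Unset Implicit Arguments.

(* All families are indexed by the whole of [I]; their values outside of [E]
   (for [C], outside of E_3) are unconstrained and never used.  Disjointness of
   the groups is obtained by working in the disjoint union {x : I & G x}. *)
Record group_triple (I : Type) (E : I -> I -> Prop) := GroupTriple {
  gt_G : I -> groupType;
  gt_H : forall x y : I, set (gt_G x);
  gt_K : forall x y : I, set (gt_G y);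
  gt_phi : forall x y : I, set (gt_G x) -> set (gt_G y);
  gt_C : forall x y z : I, set (gt_G x);
  gt_phiP : forall x y, E x y ->
    quotient_isomorphism (gt_H x y) (gt_K x y) (gt_phi x y);
  gt_CP : forall x y z, E x y -> E y z ->
    cosets (gt_H x y \o* gt_H x z) (gt_C x y z)
}.

Arguments group_triple {I} E.
Arguments gt_G {I E} F x : rename.
Arguments gt_H {I E} F x y : rename.
Arguments gt_K {I E} F x y : rename.
Arguments gt_phi {I E} F x y D : rename.
Arguments gt_C {I E} F x y z : rename.

Section SemiFrames.
Variables (I : Type) (E : I -> I -> Prop) (F : group_triple E).

Local Notation G := (gt_G F).
Local Notation H := (gt_H F).
Local Notation K := (gt_K F).
Local Notation phi := (gt_phi F).
Local Notation C := (gt_C F).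

Definition phi_img (x y : I) (Q : set (G x)) : set (G y) :=
  \bigcup_(D in [set D | cosets (H x y) D /\ D `<=` Q]) phi x y D.

(* phi_xy^-1[Q], as a subset of G_x *)
Definition phi_preimg (x y : I) (Q : set (G y)) : set (G x) :=
  \bigcup_(D in [set D | cosets (H x y) D /\ phi x y D `<=` Q]) D.

Record semi_frame : Prop := SemiFrame {
  sf_id : forall x, [/\ H x x = [set 1], K x x = [set 1]
    & forall D, cosets [set 1] D -> phi x x D = D];
  sf_inv : forall x y, E x y -> [/\ H y x = K x y, K y x = H x y,
      (forall D, cosets (H x y) D -> phi y x (phi x y D) = D)
    & forall D, cosets (K x y) D -> phi x y (phi y x D) = D];
  sf_img : forall x y z, E x y -> E y z ->
    phi_img x y (H x y \o* H x z) = K x y \o* H y z;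
  sf_comp : forall x y z, E x y -> E y z ->
    forall D, cosets (H x y \o* H x z) D ->
    phi_img y z (phi_img x y D)
      = phi_img x z ((C x y z)^-1* \o* D \o* C x y z)
}.

Record coset_conditions : Prop := CosetConditions {
  cc_id : forall x y, E x y -> C x y y = H x y;
  cc_flip : forall x y z, E x y -> E y z ->
    phi_img x z (C x y z) = (C z y x)^-1*;
  cc_swap : forall x y z, E x y -> E y z ->
    phi_img x y (C x y z) = (C y x z)^-1*;
  cc_assoc : forall x y z w, E x y -> E x z -> E x w ->
    C x y z \o* C x z w = phi_img y x (C y z w \o* H y x) \o* C x y w
}.

End SemiFrames.

Arguments phi_img {I E} F x y Q.
Arguments phi_preimg {I E} F x y Q.
Arguments semi_frame {I E} F.
Arguments coset_conditions {I E} F.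

(* Enumerations of the cosets, indexed by initial segments of a well-ordered
   type [Ord] (the ordinals), with \bot as the ordinal 0. *)
Record coset_enumeration (I : Type) (E : I -> I -> Prop) (F : group_triple E)
    (d : Order.disp_t) (Ord : bOrderType d) := CosetEnumeration {
  kappa : I -> I -> Ord;
  ce_H : forall x y : I, Ord -> set (gt_G F x);
  ce_bij : forall x y, E x y ->
    set_bij [set g | (g < kappa x y)%O] (cosets (gt_H F x y)) (ce_H x y);
  ce_0 : forall x y, E x y -> ce_H x y \bot%O = gt_H F x y;
  ce_kappa : forall x y, E x y -> kappa y x = kappa x y;
  ce_sym : forall x y, E x y -> forall g, (g < kappa x y)%O ->
    ce_H y x g = gt_phi F x y (ce_H x y g)
}.

Arguments coset_enumeration {I E} F {d} Ord.
Arguments kappa {I E F d Ord} e x y : rename.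
Arguments ce_H {I E F d Ord} e x y g : rename.

Set Implicit Arguments.

(* An algebra whose universe [ra_dom] is a subset of an ambient type [T]; the
   operations only matter on [ra_dom]. *)
Record ra_structure (T : Type) := RaStructure {
  ra_dom : set T;
  ra_add : T -> T -> T;
  ra_opp : T -> T;
  ra_mul : T -> T -> T;
  ra_conv : T -> T;
  ra_id : T
}.

Section RelationAlgebras.
Variables (T : Type) (A : ra_structure T).

Local Notation dom := (ra_dom A).
Local Notation "r + s" := (ra_add A r s).
Local Notation "- r" := (ra_opp A r).
Local Notation "r ** s" := (ra_mul A r s) (at level 40, left associativity).
Local Notation "r ^c" := (ra_conv A r) (at level 2, format "r ^c").
Local Notation "1'" := (ra_id A).

Record relation_algebra : Prop := RelationAlgebra {
  ra_domD : forall r s, dom r -> dom s -> dom (r + s);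
  ra_domN : forall r, dom r -> dom (- r);
  ra_domM : forall r s, dom r -> dom s -> dom (r ** s);
  ra_domC : forall r, dom r -> dom r^c;
  ra_domI : dom 1';
  ra_addC : forall r s, dom r -> dom s -> r + s = s + r;
  ra_addA : forall r s t, dom r -> dom s -> dom t -> r + (s + t) = (r + s) + t;
  ra_huntington : forall r s, dom r -> dom s -> - (- r + s) + - (- r + - s) = r;
  ra_mulA : forall r s t, dom r -> dom s -> dom t -> r ** (s ** t) = (r ** s) ** t;
  ra_mulI : forall r, dom r -> r ** 1' = r;
  ra_convK : forall r, dom r -> r^c^c = r;
  ra_convM : forall r s, dom r -> dom s -> (r ** s)^c = s^c ** r^c;
  ra_mulDl : forall r s t, dom r -> dom s -> dom t ->
    (r + s) ** t = (r ** t) + (s ** t);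
  ra_convD : forall r s, dom r -> dom s -> (r + s)^c = r^c + s^c;
  ra_tarski : forall r s, dom r -> dom s -> (r^c ** - (r ** s)) + - s = - s
}.

Definition ra_one : T := 1' + - 1'.
Definition ra_zero : T := - ra_one.
Definition ra_le (r s : T) : Prop := r + s = s.

Definition ra_atom (a : T) : Prop :=
  [/\ dom a, a <> ra_zero
    & forall r, dom r -> ra_le r a -> r = ra_zero \/ r = a].

(* [s] is the sum (least upper bound) of the set [X] of elements *)
Definition ra_sum (X : set T) (s : T) : Prop :=
  [/\ X `<=` dom, dom s, (forall r, X r -> ra_le r s)
    & forall t, dom t -> (forall r, X r -> ra_le r t) -> ra_le s t].

Definition ra_complete : Prop := forall X, X `<=` dom -> exists s, ra_sum X s.

Definition ra_atomic : Prop :=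
  forall r, dom r -> r <> ra_zero -> exists2 a, ra_atom a & ra_le a r.

Definition ra_functional (f : T) : Prop := dom f /\ ra_le (f^c ** f) 1'.

Definition ra_subid_atom (x : T) : Prop := ra_atom x /\ ra_le x 1'.

Definition ra_measurable_atom (x : T) : Prop :=
  ra_subid_atom x /\
  exists2 X, X `<=` ra_functional & ra_sum X (x ** ra_one ** x).

(* The measure of a measurable atom [x] is the cardinality of this set. *)
Definition ra_measure_set (x : T) : set T :=
  [set f | [/\ ra_functional f, f <> ra_zero & ra_le f (x ** ra_one ** x)]].

Definition ra_measurable : Prop :=
  exists2 X, X `<=` ra_measurable_atom & ra_sum X 1'.

End RelationAlgebras.

Unset Implicit Arguments.

Section CosetAlgebra.
Variables (I : Type) (E : I -> I -> Prop) (F : group_triple E).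
Variables (d : Order.disp_t) (Ord : bOrderType d).
Variable e : coset_enumeration F Ord.

Local Notation G := (gt_G F).
Local Notation V := {x : I & G x}.

Definition inG (x : I) (X : set (G x)) : set V := existT _ x @` X.

Definition base : set V := \bigcup_x inG x setT.

Definition unitE : set (V * V) :=
  \bigcup_(xy in [set xy | E xy.1 xy.2])
    (inG xy.1 setT `*` inG xy.2 setT).

Definition ce_K (x y : I) (g : Ord) : set (G y) := gt_phi F x y (ce_H e x y g).

Definition R (x y : I) (a : Ord) : set (V * V) :=
  \bigcup_(g in [set g | (g < kappa e x y)%O])
    (inG x (ce_H e x y g) `*` inG y (ce_K x y g \o* ce_K x y a)).

Definition relsR : set (set (V * V)) :=
  [set r | exists x y a, [/\ E x y, (a < kappa e x y)%O & r = R x y a]].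

Definition domA : set (set (V * V)) :=
  [set S | exists2 X, X `<=` relsR & S = \bigcup_(r in X) r].

(* R_(xy,a) (x) R_(yz,b) *)
Definition otimesR (x y z : I) (a b : Ord) : set (V * V) :=
  \bigcup_(g in [set g | (g < kappa e x z)%O /\
      ce_H e x z g `<=`
        phi_preimg F x y (ce_K x y a \o* ce_H e y z b) \o* gt_C F x y z])
    R x z g.

(* The product of two of the relations R; it is empty unless the middle indices
   agree. *)
Definition otimes_rels (r s : set (V * V)) : set (V * V) :=
  [set p | exists x y z a b,
     [/\ E x y /\ (a < kappa e x y)%O, E y z /\ (b < kappa e y z)%O,
         r = R x y a, s = R y z b & otimesR x y z a b p]].

(* Distinct relations R are disjoint and non-empty, so an element of [domA] is
   the union of exactly those R it contains: this is the extension of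
   [otimes_rels] by complete distributivity. *)
Definition otimes (S T : set (V * V)) : set (V * V) :=
  \bigcup_(r in [set r | relsR r /\ r `<=` S])
    \bigcup_(s in [set s | relsR s /\ s `<=` T]) otimes_rels r s.

Definition coset_algebra : ra_structure (set (V * V)) := {|
  ra_dom := domA;
  ra_add := fun S T => S `|` T;
  ra_opp := fun S => unitE `\` S;
  ra_mul := otimes;
  ra_conv := fun S => [set p | S (p.2, p.1)];
  ra_id := [set p | base p.1 /\ p.1 = p.2]
|}.

End CosetAlgebra.

Arguments R {I E F d Ord} e x y a.
Arguments coset_algebra {I E F d Ord} e.
Arguments base {I E} F.
Arguments unitE {I E} F.

(* Main.v *)
(* Choose representatives: R_(xy,alpha) depends only on the coset of H_xy with
   index alpha, and for a in that coset it consists of the pairs (g, h) such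
   that phi_xy sends the coset of g a to the coset of h.  The relations
   R_(xy,alpha) partition E, so a member of the algebra is determined by the
   atoms it contains, and the relation algebra axioms reduce to properties of
   the ternary relation "c lies in a b' C_xyz for some b' in G_x that phi_xy
   relates to b" on representatives.  Associativity comes from semi-frame
   condition (iv) and coset condition (4); the laws for converse come from (iv),
   coset condition (2) and coset condition (3), the latter giving the Peircean
   law equivalent to Tarski's axiom; the identity law is coset condition (1). *)

Require Import Defs.
From Stdlib Require Import Eqdep.
From mathcomp Require Import boolp.

Set Implicit Arguments.
Unset Strict Implicit.
Unset Printing Implicit Defensive.

Local Open Scope classical_set_scope.
Local Open Scope group_scope.

(** * Cosets and quotient isomorphisms *)

Section Cosets.
Variable G : groupType.
Implicit Types (a b : G) (M N : set G).

Lemma normal1 N : normal_subgroup N -> N 1.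
Proof. by case. Qed.

Lemma normalV N a : normal_subgroup N -> N a -> N a^-1.
Proof. by case=> N1 NB _ Na; rewrite -[a^-1]mul1g; apply: NB. Qed.

Lemma normalM N a b : normal_subgroup N -> N a -> N b -> N (a * b).
Proof.
by move=> nN Na Nb; rewrite -[b]invgK; case: (nN) => _ + _; apply=> //;
  apply: normalV.
Qed.

Lemma normalJ N b a : normal_subgroup N -> N a -> N (b^-1 * a * b).
Proof. by move=> [_ _ NJ] Na; apply: NJ. Qed.

Lemma in_coset N a b : ([set a] \o* N) b <-> N (a^-1 * b).
Proof.
split; first by case=> _ -> [n Nn <-]; rewrite mulKg.
by move=> Nab; exists a => //; exists (a^-1 * b); rewrite ?mulVKg.
Qed.

Lemma normal_setmulg M N :
  normal_subgroup M -> normal_subgroup N -> normal_subgroup (M \o* N).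
Proof.
move=> nM nN; split.
- by exists 1; [exact: normal1|exists 1; [exact: normal1|rewrite mulg1]].
- move=> _ _ [a Ma [b Nb <-]] [c Mc [d Nd <-]].
  (* Regroup a b (c d)^-1 as a c^-1 times c (b d^-1) c^-1; normality of [N] handles the second
     factor. *)
  exists (a * c^-1); first by apply: normalM => //; apply: normalV.
  exists ((c^-1)^-1 * (b * d^-1) * c^-1); last by rewrite ?gnorm.
  by apply: normalJ => //; apply: normalM => //; apply: normalV.
- move=> _ c [a Ma [b Nb <-]].
  exists (c^-1 * a * c); first exact: normalJ.
  by exists (c^-1 * b * c); [exact: normalJ|by rewrite ?gnorm].
Qed.

(** Congruence modulo [N] replaces equality of cosets, so that later computations take place on
    elements of the groups. *)
Definition eqmod N a b := N (a^-1 * b).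

Section Eqmod.
Variable N : set G.
Hypothesis nN : normal_subgroup N.

Lemma eqmod_refl a : eqmod N a a.
Proof. by rewrite /eqmod mulVg; apply: normal1. Qed.

Lemma eqmod_sym a b : eqmod N a b -> eqmod N b a.
Proof. by move=> /(normalV nN); rewrite /eqmod invgM invgK. Qed.

Lemma eqmod_trans b a c : eqmod N a b -> eqmod N b c -> eqmod N a c.
Proof.
by move=> ab /(normalM nN ab); rewrite /eqmod ?gnorm.
Qed.

Lemma eqmodM a b a' b' : eqmod N a a' -> eqmod N b b' ->
  eqmod N (a * b) (a' * b').
Proof.
rewrite /eqmod => /(normalJ b nN) aa' bb'.
by have := normalM nN aa' bb'; rewrite ?gnorm.
Qed.

Lemma coset_closed a b c : ([set a] \o* N) b -> N (b^-1 * c) ->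
  ([set a] \o* N) c.
Proof. by move=> /in_coset ab bc; apply/in_coset; apply: eqmod_trans bc. Qed.

Lemma coset_refl a : ([set a] \o* N) a.
Proof. exact/in_coset/eqmod_refl. Qed.

Lemma coset_cosets a : cosets N ([set a] \o* N).
Proof. by exists a. Qed.

Lemma cosetsE D a : cosets N D -> D a -> D = [set a] \o* N.
Proof.
case=> b _ <- /in_coset ba; apply/seteqP; split=> c /in_coset bc;
  apply/in_coset.
  exact: eqmod_trans (eqmod_sym ba) bc.
exact: eqmod_trans ba bc.
Qed.

Lemma cosets_neq0 D : cosets N D -> exists a, D a.
Proof. by case=> b _ <-; exists b; apply: coset_refl. Qed.

Lemma coset_eq a b : eqmod N a b -> [set a] \o* N = [set b] \o* N.
Proof. by move=> ab; apply: cosetsE; [exact: coset_cosets|exact/in_coset]. Qed.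

Lemma cosets_eqmod D a b : cosets N D -> D a -> D b <-> eqmod N a b.
Proof. by move=> ND Da; rewrite (cosetsE ND Da) in_coset. Qed.

End Eqmod.

Lemma cosetsM N D D' : normal_subgroup N -> cosets N D -> cosets N D' ->
  cosets N (D \o* D').
Proof.
move=> nN [a _ <-] [b _ <-]; exists (a * b) => //; apply/seteqP; split=> c.
  move=> /in_coset abc; exists a; first exact: coset_refl.
  by exists (a^-1 * c); [apply/in_coset; move: abc;
    rewrite ?gnorm|rewrite mulVKg].
case=> a' /in_coset aa' [b' /in_coset bb' <-]; apply/in_coset.
exact: (eqmodM nN aa' bb').
Qed.

End Cosets.

(* [graph_of f] is the subgroup of G x G' made of the pairs (a, b) such that
   [f] maps the coset of a to the coset of b. *)
Definition graph_of (G G' : groupType) (H : set G) (f : set G -> set G')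
  (a : G) (b : G') := f ([set a] \o* H) b.

(** * Quotient isomorphisms as relations between elements *)

Section Graph.
Variables (G G' : groupType) (H : set G) (K : set G') (f : set G -> set G').
Hypothesis fP : quotient_isomorphism H K f.
Local Notation P := (graph_of H f).

Let nH : normal_subgroup H. Proof. by case: fP. Qed.
Let nK : normal_subgroup K. Proof. by case: fP. Qed.

Lemma graph_cosets a : cosets K (f ([set a] \o* H)).
Proof. by case: fP => _ _ [fK _ _] _; apply: fK; exists a. Qed.

Lemma graph_total a : exists b, P a b.
Proof. exact: cosets_neq0 (graph_cosets a). Qed.

Lemma graph_onto b : exists a, P a b.
Proof.
case: fP => _ _ [_ _ fK] _; have [_ [a _ <-] fab] := fK _ (coset_cosets K b).
by exists a; rewrite /graph_of fab; apply: coset_refl.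
Qed.

Lemma graphM a b a' b' : P a b -> P a' b' -> P (a * a') (b * b').
Proof.
move=> Pab Pab'; have [_ _ _ fM] := fP.
rewrite /graph_of (_ : _ \o* _ = ([set a] \o* H) \o* ([set a'] \o* H)).
  by rewrite fM; [exists b => //; exists b'|exists a|exists a'].
symmetry; apply: cosetsE => //; first by apply: cosetsM => //;
  apply: coset_cosets.
by exists a; [exact: coset_refl|exists a' => //; exact: coset_refl].
Qed.

Lemma graph_eqr a b b' : P a b -> P a b' <-> eqmod K b b'.
Proof. by move=> Pab; apply: cosets_eqmod => //; apply: graph_cosets. Qed.

Lemma graph_eql a a' b : P a b -> P a' b <-> eqmod H a a'.
Proof.
move=> Pab; split; last by move=> aa'; rewrite /graph_of -(coset_eq nH aa').
move=> Pa'b; case: fP => _ _ [_ finj _] _.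
rewrite /eqmod -in_coset (finj ([set a] \o* H) ([set a'] \o* H));
  first exact: coset_refl.
- by rewrite inE; exists a.
- by rewrite inE; exists a'.
- rewrite (cosetsE nK (graph_cosets a) Pab).
  by rewrite (cosetsE nK (graph_cosets a') Pa'b).
Qed.

(** If 1 is related to b, then multiplicativity relates it to b b as well, so b and b b are
    congruent modulo [K] and b lies in [K]. *)
Lemma graph1 : P 1 1.
Proof.
have [b P1b] := graph_total 1.
apply/(graph_eqr _ P1b); have := graphM P1b P1b; rewrite mulg1.
move=> /(graph_eqr _ P1b); rewrite /eqmod ?gnorm => Kb.
exact: normalV.
Qed.

Lemma graphV a b : P a b -> P a^-1 b^-1.
Proof.
move=> Pab; have [c Pc] := graph_total a^-1.
have := graphM Pab Pc; rewrite mulgV => /(graph_eqr _ graph1).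
rewrite /eqmod invg1 mul1g => Kbc; apply/(graph_eqr _ Pc).
by apply: eqmod_sym => //; rewrite /eqmod invgK.
Qed.

Lemma graph1l a : P a 1 <-> H a.
Proof. by rewrite (graph_eql _ graph1) /eqmod invg1 mul1g. Qed.

End Graph.

(** * Semi-frames on representatives *)

Section CosetAlgebra.
Variables (I : Type) (E : I -> I -> Prop).
Hypothesis eqE : Equivalence E.
Variable F : group_triple E.
Hypotheses (sfF : semi_frame F) (ccF : coset_conditions F).
Implicit Types x y z w : I.

Local Notation G := (gt_G F).
Local Notation H := (gt_H F).
Local Notation K := (gt_K F).
Local Notation phi := (gt_phi F).
Local Notation C := (gt_C F).
Local Notation P x y := (graph_of (H x y) (phi x y)).

Let Exx x : E x x. Proof. exact: (@Equivalence_Reflexive _ _ eqE). Qed.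
Let Esym x y : E x y -> E y x.
Proof. exact: (@Equivalence_Symmetric _ _ eqE). Qed.
Let Etrans y x z : E x y -> E y z -> E x z.
Proof. exact: (@Equivalence_Transitive _ _ eqE). Qed.
Hint Resolve Exx Esym : core.

(** The normal subgroup of which C_xyz is a coset; products of representatives are determined only
    modulo it. *)
Definition gt_N x y z : set (G x) := H x y \o* H x z.
Local Notation N := (@gt_N).

Lemma normalH x y : E x y -> normal_subgroup (H x y).
Proof. by move=> Exy; have [] := gt_phiP _ _ F x y Exy. Qed.

Lemma normalN x y z : E x y -> E x z -> normal_subgroup (N x y z).
Proof. by move=> Exy Exz; apply: normal_setmulg; apply: normalH. Qed.

Lemma HsubNl x y z a : E x z -> H x y a -> N x y z a.
Proof.
by move=> Exz Ha; exists a => //; exists 1; rewrite ?mulg1 //;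
  exact: normal1 (normalH Exz).
Qed.

Lemma HsubNr x y z a : E x y -> H x z a -> N x y z a.
Proof.
by move=> Exy Ha; exists 1; [exact: normal1 (normalH Exy)|exists a;
  rewrite ?mul1g].
Qed.

Lemma KE x y : E x y -> K x y = H y x.
Proof. by move=> Exy; have [] := sf_inv _ _ _ sfF x y Exy. Qed.

Lemma P_sym x y a b : E x y -> P x y a b -> P y x b a.
Proof.
move=> Exy Pab; have [Hyx _ phiK _] := sf_inv _ _ _ sfF x y Exy.
have fP := gt_phiP _ _ F x y Exy.
rewrite /graph_of Hyx -(@cosetsE _ _ _ (phi x y ([set a] \o* H x y))) //.
- by rewrite phiK; [apply: coset_refl (normalH Exy) _|exists a].
- by case: fP.
- exact: (graph_cosets fP).
Qed.

Lemma P_total x y a : E x y -> exists b, P x y a b.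
Proof. by move=> Exy; apply: (graph_total (gt_phiP _ _ F x y Exy)). Qed.

Lemma P_onto x y b : E x y -> exists a, P x y a b.
Proof. by move=> Exy; apply: (graph_onto (gt_phiP _ _ F x y Exy)). Qed.

Lemma PM x y a b a' b' : E x y -> P x y a b -> P x y a' b' ->
  P x y (a * a') (b * b').
Proof. by move=> Exy; apply: (graphM (gt_phiP _ _ F x y Exy)). Qed.

Lemma PV x y a b : E x y -> P x y a b -> P x y a^-1 b^-1.
Proof. by move=> Exy; apply: (graphV (gt_phiP _ _ F x y Exy)). Qed.

Lemma P_eqr x y a b b' : E x y -> P x y a b ->
  P x y a b' <-> eqmod (H y x) b b'.
Proof. by move=> Exy; rewrite -(KE Exy);
  apply: (graph_eqr (gt_phiP _ _ F x y Exy)). Qed.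

Lemma P_eql x y a a' b : E x y -> P x y a b ->
  P x y a' b <-> eqmod (H x y) a a'.
Proof. by move=> Exy; apply: (graph_eql (gt_phiP _ _ F x y Exy)). Qed.

Lemma P1 x y : E x y -> P x y 1 1.
Proof. by move=> Exy; apply: (graph1 (gt_phiP _ _ F x y Exy)). Qed.

Lemma P1l x y a : E x y -> P x y a 1 <-> H x y a.
Proof. by move=> Exy; apply: (graph1l (gt_phiP _ _ F x y Exy)). Qed.

Lemma Hxx x : H x x = [set 1].
Proof. by have [] := sf_id _ _ _ sfF x. Qed.

Lemma Pxx x a b : P x x a b <-> a = b.
Proof.
have [Hx _ phixx] := sf_id _ _ _ sfF x.
rewrite /graph_of Hx phixx; last by exists a.
rewrite in_coset; split=> [/= ab|->]; last by rewrite mulVg.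
by rewrite -[b](mulVKg a) ab mulg1.
Qed.

(** * Images and preimages under phi_xy on elements *)

(** [phi_img] only sees the cosets that lie inside [Q]. Closure of [Q] under H_xy puts the whole
    coset of each element of [Q] inside [Q], so the image can be taken element by element. *)
Lemma phi_imgE x y (Q : set (G x)) b : E x y ->
    (forall a h, Q a -> H x y h -> Q (a * h)) ->
  phi_img F x y Q b <-> exists2 a, Q a & P x y a b.
Proof.
move=> Exy Qs; split=> [[D [HD DQ] Db]|[a Qa Pab]].
  have [a Da] := cosets_neq0 (normalH Exy) HD.
  by exists a; [exact: DQ|rewrite /graph_of -(cosetsE _ HD Da) //;
    apply: normalH].
exists ([set a] \o* H x y) => //; split; first by exists a.
by move=> _ [_ -> [h Hh <-]]; apply: Qs.
Qed.

Lemma phi_preimgE x y (Q : set (G y)) a : E x y ->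
    (forall b k, Q b -> H y x k -> Q (b * k)) ->
  phi_preimg F x y Q a <-> exists2 b, Q b & P x y a b.
Proof.
move=> Exy Qs; split=> [[D [HD DQ] Da]|[b Qb Pab]].
  have [b Pab] := P_total a Exy.
  exists b => //; apply: DQ; rewrite (cosetsE _ HD Da) //; exact: normalH.
exists ([set a] \o* H x y); last by apply: coset_refl; apply: normalH.
split; first by exists a.
by move=> c /(P_eqr _ Exy Pab) bc; rewrite -[c](mulVKg b); apply: Qs.
Qed.

Lemma N_saturated x y z a h : E x y -> E x z ->
  N x y z a -> H x y h -> N x y z (a * h).
Proof.
move=> Exy Exz Na Hh; apply: normalM => //; first exact: normalN.
exact: HsubNl.
Qed.

(** Semi-frame condition (iii) on elements. The backward direction also needs that two preimages of
    b differ by H_xy, which N_xyz contains. *)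
Lemma P_N x y z a b : E x y -> E y z -> P x y a b -> N x y z a <-> N y x z b.
Proof.
move=> Exy Eyz Pab; have Exz := Etrans Exy Eyz.
have Ni b' := phi_imgE b' Exy (fun a h => @N_saturated x y z a h Exy Exz).
have := sf_img _ _ _ sfF x y z Exy Eyz;
  rewrite KE // -/(N x y z) -/(N y x z) => NN.
split=> Na; first by rewrite -NN Ni; exists a.
move: Na; rewrite -NN Ni => -[a' Na' /(P_eql _ Exy Pab) /(eqmod_sym (normalH
  Exy)) a'a].
by rewrite -[a](mulVKg a'); apply: N_saturated.
Qed.

Lemma P_eqmodN x y z a b a' b' : E x y -> E y z -> P x y a b -> P x y a' b' ->
  eqmod (N x y z) a a' <-> eqmod (N y x z) b b'.
Proof. by move=> Exy Eyz Pab Pab'; apply/P_N/PM => //; apply: PV. Qed.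

(** * The cosets C_xyz and semi-frame condition (iv) on elements *)

Lemma C_neq0 x y z : E x y -> E y z -> exists u, C x y z u.
Proof.
move=> Exy Eyz; apply: cosets_neq0 (gt_CP _ _ F x y z Exy Eyz).
by apply: normalN => //; apply: Etrans Eyz.
Qed.

Lemma C_eqmod x y z u v : E x y -> E y z -> C x y z u ->
  C x y z v <-> eqmod (N x y z) u v.
Proof.
move=> Exy Eyz; apply: cosets_eqmod (gt_CP _ _ F x y z Exy Eyz).
by apply: normalN => //; apply: Etrans Eyz.
Qed.

Lemma C_mulN x y z u h : E x y -> E y z -> C x y z u -> N x y z h ->
  C x y z (u * h).
Proof. by move=> Exy Eyz Cu Nh; apply/(C_eqmod _ Exy Eyz Cu);
  rewrite /eqmod mulKg. Qed.

(** Coset condition (3) on elements. *)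
Lemma C_swap x y z u v : E x y -> E y z -> P x y u v ->
  C x y z u -> C y x z v^-1.
Proof.
move=> Exy Eyz Puv Cu; have Exz := Etrans Exy Eyz.
suff: (C y x z)^-1* v by move=> [w Cw <-]; rewrite invgK.
rewrite -(cc_swap _ _ _ ccF) // phi_imgE //; first by exists u.
by move=> a h Ca Hh; apply: C_mulN => //; apply: HsubNl.
Qed.

(** Coset condition (2) on elements. *)
Lemma C_flip x y z u v : E x y -> E y z -> P x z u v ->
  C x y z u -> C z y x v^-1.
Proof.
move=> Exy Eyz Puv Cu; have Exz := Etrans Exy Eyz.
suff: (C z y x)^-1* v by move=> [w Cw <-]; rewrite invgK.
rewrite -(cc_flip _ _ _ ccF) // phi_imgE //; first by exists u.
by move=> a h Ca Hh; apply: C_mulN => //; apply: HsubNr.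
Qed.

Lemma phi_img2E x y z a c : E x y -> E y z ->
  phi_img F y z (phi_img F x y ([set a] \o* N x y z)) c <->
  exists a' b, [/\ eqmod (N x y z) a a', P x y a' b & P y z b c].
Proof.
move=> Exy Eyz; have Exz := Etrans Exy Eyz; have nN := normalN Exy Exz.
have imgE b : phi_img F x y ([set a] \o* N x y z) b <->
    exists2 a', eqmod (N x y z) a a' & P x y a' b.
  rewrite phi_imgE //.
    by split=> -[a' aa' Pa']; exists a' => //; apply/in_coset.
  by move=> a' h aa' Hh; apply: coset_closed aa' _ => //; rewrite mulKg;
    apply: HsubNl.
rewrite phi_imgE //.
  split=> [[b /imgE [a' aa' Pa'] Pb]|[a' [b [aa' Pa' Pb]]]];
    first by exists a', b.
  by exists b => //; apply/imgE; exists a'.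
(* The inner image must be closed under H_yz for [phi_imgE] to apply a second time: an element h of
   H_yz pulls back along phi_xy into N_xyz. *)
move=> b h /imgE [a' aa' Pa'] Hh; have [m Pm] := P_onto h Exy.
apply/imgE; exists (a' * m); last exact: PM.
apply: (eqmod_trans nN aa'); rewrite /eqmod mulKg.
by apply/(P_N Exy Eyz Pm)/HsubNr => //; apply: Esym.
Qed.

(** Since C_xyz is the coset of u and N_xyz is normal, the conjugated set is the coset of u^-1 a u;
    the right side says this without inverses. *)
Lemma conj_cosetE x y z u a g : E x y -> E y z -> C x y z u ->
  ((C x y z)^-1* \o* ([set a] \o* N x y z) \o* C x y z) g <->
  eqmod (N x y z) (a * u) (u * g).
Proof.
move=> Exy Eyz Cu; have nN := normalN Exy (Etrans Exy Eyz).
split=> [[_ [_ [v Cv <-] [b /in_coset ab <-]] [w Cw <-]]|].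
  have uv := (C_eqmod v Exy Eyz Cu).1 Cv;
    have uw := (C_eqmod w Exy Eyz Cu).1 Cw.
  apply: eqmod_trans (eqmodM nN ab uw) _ => //.
  rewrite -{1}[b * w](mulVKg v) !mulgA -!mulgA.
  by apply: eqmodM (eqmod_sym nN uv) _ => //; apply: eqmod_refl.
move=> /(normalJ u^-1 nN); rewrite ?gnorm => aug.
exists (u^-1 * (u * g * u^-1)); last by exists u => //; rewrite ?gnorm.
exists u^-1; first by exists u.
by exists (u * g * u^-1) => //; apply/in_coset; rewrite ?gnorm.
Qed.

(* The two inclusions of the semi-frame condition (iv), on elements. *)
Lemma P_comp x y z a b c u : E x y -> E y z -> C x y z u ->
    P x y a b -> P y z b c ->
  exists2 a', P x z a' c & eqmod (N x y z) (a * u) (u * a').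
Proof.
move=> Exy Eyz Cu Pab Pbc; have Exz := Etrans Exy Eyz;
  have nN := normalN Exy Exz.
have: phi_img F y z (phi_img F x y ([set a] \o* N x y z)) c.
  by apply/phi_img2E => //; exists a, b; split=> //; apply: eqmod_refl.
rewrite (sf_comp _ _ _ sfF) //; last by exists a.
move=> [D [HD DC] Dc]; have nH := normalH Exz.
have [a' Da'] := cosets_neq0 nH HD; exists a'.
  by rewrite /graph_of -(cosetsE nH HD Da').
by apply/conj_cosetE => //; apply: DC.
Qed.

Lemma P_decomp x y z a' c u : E x y -> E y z -> C x y z u -> P x z a' c ->
  exists a b, [/\ P x y a b, P y z b c & eqmod (N x y z) (a * u) (u * a')].
Proof.
move=> Exy Eyz Cu Pa'; have Exz := Etrans Exy Eyz; have nN := normalN Exy Exz.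
(* Conjugation by C_xyz carries the coset of u a' u^-1 to that of a', so (iv) is applied to this
   coset. *)
have: phi_img F y z (phi_img F x y ([set u * a' * u^-1] \o* N x y z)) c.
  rewrite (sf_comp _ _ _ sfF) //; last by exists (u * a' * u^-1).
  apply/phi_imgE => //.
    move=> g h /(conj_cosetE _ _ Exy Eyz Cu) ug Hh.
    apply/(conj_cosetE _ _ Exy Eyz Cu); apply: eqmod_trans ug _ => //.
    by rewrite /eqmod ?gnorm; apply: HsubNr.
  exists a' => //; apply/(conj_cosetE _ _ Exy Eyz Cu).
  by rewrite mulgVK; apply: eqmod_refl.
move=> /phi_img2E -/(_ Exy Eyz) [a [b [ua Pab Pbc]]].
exists a, b; split=> //; apply: eqmod_sym => //.
by have := eqmodM nN ua (eqmod_refl nN u); rewrite mulgVK.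
Qed.

(* The relation R_(xz) of the coset of c lies in the product of R_(xy) of the
   coset of a with R_(yz) of the coset of b. *)
Definition atom_mul x y z (a : G x) (b : G y) (c : G x) :=
  exists b' u, [/\ P x y b' b, C x y z u & c = a * b' * u].
Local Notation T := (@atom_mul).

(** For fixed a and b the possible c form a single coset of N_xyz: b' varies within a coset of H_xy
    and u within a coset of N_xyz. *)
Lemma atom_mulE x y z a b c b' u : E x y -> E y z -> P x y b' b -> C x y z u ->
  T x y z a b c <-> eqmod (N x y z) (a * b' * u) c.
Proof.
move=> Exy Eyz Pb Cu; have Exz := Etrans Exy Eyz; have nN := normalN Exy Exz.
split=> [[b1 [v [Pb1 Cv ->]]]|abc].
  apply: (eqmodM nN); last exact/(C_eqmod _ Exy Eyz Cu).
  apply: (eqmodM nN); first exact: eqmod_refl.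
  by apply: HsubNl => //; apply/(P_eql _ Exy Pb).
exists b', (u * ((a * b' * u)^-1 * c)); split=> //; first exact: C_mulN.
by rewrite mulgA mulVKg.
Qed.

(** Makes [atom_mul] a relation between atoms. Changes of a and c stay inside N_xyz, which contains
    H_xy and H_xz; a change of b by H_yz moves its preimage by an element of N_xyz. *)
Lemma atom_mul_eqmod x y z a b c a' b' c' : E x y -> E y z ->
  eqmod (H x y) a a' -> eqmod (H y z) b b' -> eqmod (H x z) c c' ->
  T x y z a b c -> T x y z a' b' c'.
Proof.
move=> Exy Eyz aa' bb' cc'; have Exz := Etrans Exy Eyz;
  have nN := normalN Exy Exz.
have [b1 Pb1] := P_onto b Exy; have [b1' Pb1'] := P_onto b' Exy.
have [u Cu] := C_neq0 Exy Eyz.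
move=> /(atom_mulE _ _ Exy Eyz Pb1 Cu) abc;
  apply/(atom_mulE _ _ Exy Eyz Pb1' Cu).
apply: (eqmod_trans nN) (HsubNr Exy cc'); apply: (eqmod_trans nN) abc.
apply: (eqmodM nN); last exact: eqmod_refl.
apply: eqmod_sym => //; apply: (eqmodM nN); first exact: HsubNl.
by apply/(P_eqmodN Exy Eyz Pb1 Pb1')/HsubNr => //; apply: Esym.
Qed.

(** * Identity, Peircean, converse and associative laws for [atom_mul] *)

Lemma Cxyy x y : E x y -> C x y y = H x y.
Proof. by move=> Exy; apply: (cc_id _ _ _ ccF). Qed.

Lemma atom_mulr1 x y a c : E x y -> T x y y a 1 c <-> eqmod (H x y) a c.
Proof.
move=> Exy; split=> [[b [u [/(P1l _ Exy) Hb]]]|ac].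
  rewrite Cxyy // => Hu ->; rewrite /eqmod -mulgA mulKg.
  by apply: normalM => //; apply: normalH.
exists 1, (a^-1 * c); rewrite Cxyy //; split=> //; first exact: P1.
by rewrite mulg1 mulVKg.
Qed.

(** H_xx and C_xxx are trivial, so inside one group atoms multiply like group elements. *)
Lemma atom_mulxx x a b c : T x x x a b c <-> c = a * b.
Proof.
split=> [[b' [u [/Pxx -> + ->]]]|->]; first by rewrite Cxyy // Hxx => ->;
  rewrite mulg1.
exists b, 1; rewrite mulg1; split=> //; first exact/Pxx.
by rewrite Cxyy // Hxx.
Qed.

(** Solving c = a b' u for u and applying phi_xy sends u to b^-1 a' c', where c' is an image of c.
    Its inverse lies in C_yxz by coset condition (3), and b is a' c' times that inverse. *)
Lemma atom_mul_peirce x y z a b c a' : E x y -> E y z -> P x y a^-1 a' ->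
  T x y z a b c -> T y x z a' c b.
Proof.
move=> Exy Eyz Pa [b' [u [Pb Cu ->]]].
have [c' Pc] := P_total (a * b' * u) Exy.
have Pu : P x y u (b^-1 * a' * c').
  by have := PM Exy (PM Exy (PV Exy Pb) Pa) Pc; rewrite ?gnorm.
exists c', (b^-1 * a' * c')^-1; split; first exact: P_sym.
  exact: (C_swap Exy Eyz Pu Cu).
by rewrite ?gnorm.
Qed.

Lemma atom_mul_conv x y z a b c a' b' c' : E x y -> E y z ->
    P x y a^-1 a' -> P y z b^-1 b' -> P x z c^-1 c' ->
  T x y z a b c -> T z y x b' a' c'.
Proof.
move=> Exy Eyz Pa Pb Pc [b1 [u [Pb1 Cu Dc]]].
have Exz := Etrans Exy Eyz; have nN := normalN Exy Exz.
have [a2 Pa2] := P_total a' Eyz.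
(* Transporting b1^-1 a^-1 to G_z through G_y yields b' a2, the image under phi_xz of some g with
   b1^-1 a^-1 u congruent to u g. Hence c g is congruent to u and lies in C_xyz, and coset condition
   (2) gives the last factor of c'. *)
have [g Pg eg] := P_comp Exy Eyz Cu (PM Exy (PV Exy Pb1) Pa) (PM Eyz Pb Pa2).
exists a2, ((b' * a2)^-1 * c'); split; first exact: P_sym.
  rewrite -[_ * c']invgK; apply: (C_flip Exy Eyz (u := c * g)).
    by have := PV Exz (PM Exz (PV Exz Pg) Pc); rewrite !invgM !invgK.
  apply/(C_eqmod _ Exy Eyz Cu); rewrite Dc.
  by move: eg; rewrite /eqmod ?gnorm.
by rewrite mulVKg.
Qed.

(** Coset condition (4) on elements. The factor H_yx, which makes the set under phi_yx a union of
    cosets, is absorbed because [P] depends only on cosets. *)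
Lemma C_assocE x y z w g : E x y -> E y z -> E z w ->
  (exists u v, [/\ C x y z u, C x z w v & g = u * v]) <->
  (exists t u v, [/\ C y z w t, P x y u t, C x y w v & g = u * v]).
Proof.
move=> Exy Eyz Ezw; have Exz := Etrans Exy Eyz; have Eyx := Esym Exy.
have -> : (exists u v, [/\ C x y z u, C x z w v & g = u * v]) <->
    (C x y z \o* C x z w) g.
  by split=> [[u [v [Cu Cv ->]]]|[u Cu [v Cv <-]]]; exists u => //; exists v.
rewrite (cc_assoc _ _ _ ccF) //; last exact: Etrans Ezw.
have imE u : phi_img F y x (C y z w \o* H y x) u <->
    exists2 t, C y z w t & P x y u t.
  rewrite phi_imgE //; last first.
    move=> _ h [t Ct [k Hk <-]] Hh; exists t => //; exists (k * h);
      last by rewrite mulgA.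
    by apply: normalM => //; apply: normalH.
  split=> [[_ [t Ct [k Hk <-]] /(P_sym Eyx) Pu]|[t Ct Pu]].
    exists t => //; apply/(P_eqr _ Exy Pu); apply: (eqmod_sym (normalH Eyx)).
    by rewrite /eqmod mulKg.
  exists t; last exact: P_sym.
  by exists t => //; exists 1; [exact: normal1 (normalH Eyx)|rewrite mulg1].
split=> [[u /imE [t Ct Pu] [v Cv <-]]|[t [u [v [Ct Pu Cv ->]]]]].
  by exists t, u, v.
by exists u; [apply/imE; exists t|exists v].
Qed.

Lemma atom_mul_assocl x y z w a b c t d : E x y -> E y z -> E z w ->
  T y z w b c t -> T x y w a t d ->
  exists2 s, T x y z a b s & T x z w s c d.
Proof.
move=> Exy Eyz Ezw [c2 [k [Pc2 Ck ->]]] [t1 [v [Pt1 Cv ->]]].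
have nN := normalN Exy (Etrans Exy Eyz).
have [b1 Pb1] := P_onto b Exy; have [c3 Pc3] := P_onto c2 Exy.
(* Past b1 c3, the rest of t1 is a preimage of k, so its product with v has the form that [C_assocE]
   rewrites as u1 u2. *)
have Pk : P x y ((b1 * c3)^-1 * t1) k.
  by have := PM Exy (PV Exy (PM Exy Pb1 Pc3)) Pt1; rewrite mulKg.
have [|u1 [u2 [Cu1 Cu2 e]]] := (C_assocE ((b1 * c3)^-1 * t1 * v) Exy Eyz Ezw).2.
  by exists k, ((b1 * c3)^-1 * t1), v.
have [c' Pc' ec'] := P_comp Exy Eyz Cu1 Pc3 Pc2.
(* Chosen so that s c' u2 equals d; by (iv) the factor c3 u1 c'^-1 is congruent to u1, hence lies in
   C_xyz. *)
exists (a * b1 * (c3 * u1 * c'^-1)).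
  exists b1, (c3 * u1 * c'^-1); split=> //; apply/(C_eqmod _ Exy Eyz Cu1).
  have := eqmodM nN (eqmod_sym nN ec') (eqmod_refl nN c'^-1).
  by rewrite mulgK.
exists c', u2; split=> //; move: e => /(congr1 (fun g => a * b1 * c3 * g)).
by rewrite ?gnorm.
Qed.

Lemma atom_mul_assocr x y z w a b c s d : E x y -> E y z -> E z w ->
  T x y z a b s -> T x z w s c d ->
  exists2 t, T y z w b c t & T x y w a t d.
Proof.
move=> Exy Eyz Ezw [b1 [u1 [Pb1 Cu1 ->]]] [c' [u2 [Pc' Cu2 ->]]].
have nN := normalN Exy (Etrans Exy Eyz).
(* The decomposition of c' makes c3^-1 u1 c' congruent to u1, so that its product with u2 can be
   rewritten by coset condition (4). *)
have [c3 [c2 [Pc3 Pc2 ec]]] := P_decomp Exy Eyz Cu1 Pc'.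
have [|k [k1 [v [Ck Pk Cv e]]]] := (C_assocE (c3^-1 * u1 * c' * u2) Exy Eyz
  Ezw).1.
  exists (c3^-1 * u1 * c'), u2; split=> //; apply/(C_eqmod _ Exy Eyz Cu1).
  by move: ec; rewrite /eqmod ?gnorm.
exists (b * c2 * k); first by exists c2, k.
exists (b1 * c3 * k1), v; split=> //; first by do 2 apply: PM => //.
move: e => /(congr1 (fun g => a * b1 * c3 * g)).
by rewrite ?gnorm.
Qed.

(** * The algebra *)

Local Notation V := {x : I & G x}.
Variables (d : Order.disp_t) (Ord : bOrderType d) (e : coset_enumeration F Ord).
Local Notation relsRe := (relsR _ _ _ _ _ e).
Local Notation otimesRe := (otimesR _ _ _ _ _ e).
Local Notation domAe := (domA _ _ _ _ _ e).
Local Notation otimese := (otimes _ _ _ _ _ e).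
Local Notation ce_Ke := (ce_K _ _ _ _ _ e).
Implicit Types (p q : V * V) (S : set (V * V)).

(** * The relations R_(xy,alpha) on representatives *)

Lemma eqmodH_refl x y a : E x y -> eqmod (H x y) a a.
Proof. by move=> Exy; apply: eqmod_refl; apply: normalH. Qed.
Hint Resolve eqmodH_refl : core.

(* This is R_(xy,alpha) for the index alpha of the coset of a. *)
Definition coset_rel x y (a : G x) : set (V * V) :=
  [set p | exists g h, p = (existT _ x g, existT _ y h) /\ P x y (g * a) h].
Local Notation Q := (@coset_rel).

Lemma coset_relE x y a g h :
  Q x y a (existT _ x g, existT _ y h) <-> P x y (g * a) h.
Proof.
split=> [[g' [h' [[+ +] Pga]]]|Pga]; last by exists g, h.
by move=> /(inj_pair2 _ _ _ _ _) -> /(inj_pair2 _ _ _ _ _) ->.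
Qed.

Lemma coset_rel_index x y a x' y' a' p : Q x y a p -> Q x' y' a' p -> x = x' /\
  y = y'.
Proof. by case=> g [h [-> _]] [g' [h' [[ex _ ey _] _]]]. Qed.

(** A pair (g, h) determines the coset of g a, hence that of a; this makes distinct atoms
    disjoint. *)
Lemma coset_rel_eqmod x y a b p : E x y -> Q x y a p -> Q x y b p <-> eqmod (H
  x y) a b.
Proof.
move=> Exy [g [h [-> Pga]]]; rewrite coset_relE (P_eql _ Exy Pga).
by rewrite /eqmod ?gnorm.
Qed.

Lemma coset_rel_neq0 x y a : E x y -> exists p, Q x y a p.
Proof.
move=> Exy; have [h Ph] := P_total (1 * a) Exy.
by exists (existT _ x (1 : G x), existT _ y h); apply/coset_relE.
Qed.

Lemma coset_rel_eq x y a b : E x y -> eqmod (H x y) a b -> Q x y a = Q x y b.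
Proof.
move=> Exy ab; apply/seteqP; split=> p Qp.
  exact/(coset_rel_eqmod _ Exy Qp).
by apply/(coset_rel_eqmod _ Exy Qp);
  apply: (@eqmod_sym _ _ (normalH Exy) _ _ ab).
Qed.

Lemma coset_rel_unit x y a : E x y -> Q x y a `<=` unitE F.
Proof.
by move=> Exy _ [g [h [-> _]]]; exists (x, y) => //; split; [exists g|exists h].
Qed.

Lemma coset_rel_cover p : unitE F p -> exists x y a, E x y /\ Q x y a p.
Proof.
case: p => _ _ [[x y] /= Exy [[g _ <-] [h _ <-]]].
have [k Pk] := P_onto h Exy; exists x, y, (g^-1 * k); split=> //.
by apply/coset_relE; rewrite mulVKg.
Qed.

Lemma coset_rel_swap x y a b p : E x y -> P x y a^-1 b -> Q x y a p ->
  Q y x b (p.2, p.1).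
Proof.
move=> Exy Pab [g [h [-> Pga]]]; apply/coset_relE/P_sym => //.
by have := PM Exy Pga Pab; rewrite mulgK.
Qed.

Lemma ce_cosets x y al : E x y -> (al < kappa e x y)%O ->
  cosets (H x y) (ce_H e x y al).
Proof. by move=> Exy; case: (ce_bij _ _ _ _ _ e _ _ Exy) => + _ _; apply. Qed.

Lemma ce_index x y a : E x y -> exists2 al, (al < kappa e x y)%O & ce_H e x y
  al a.
Proof.
move=> Exy; have [_ _ surj] := ce_bij _ _ _ _ _ e _ _ Exy.
have [al lt_al ce_al] := surj _ (coset_cosets (H x y) a).
by exists al => //; rewrite ce_al; apply/coset_refl/normalH.
Qed.

(** For g in H_(xy,gamma), the product of K_(xy,gamma) and K_(xy,alpha) is the image of the coset of
    g a, which eliminates the index gamma. *)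
Lemma R_coset_rel x y al a : E x y -> (al < kappa e x y)%O -> ce_H e x y al a ->
  R e x y al = Q x y a.
Proof.
move=> Exy lt_al al_a; have Dal := cosetsE (normalH Exy) (ce_cosets Exy lt_al)
  al_a.
apply/seteqP; split=> [[u v] [ga lt_ga [/= [g ga_g <-] [_ [k kP [l lP <-]]
  <-]]]|].
  apply/coset_relE/PM => //; last by move: lP; rewrite /ce_K Dal.
  by move: kP; rewrite /ce_K (cosetsE (normalH Exy) (ce_cosets Exy lt_ga) ga_g).
move=> _ [g [h [-> Pga]]]; have [ga lt_ga ga_g] := ce_index g Exy.
have [k Pk] := P_total g Exy; exists ga => //; split; first by exists g.
exists h => //; exists k.
  by rewrite /ce_K (cosetsE (normalH Exy) (ce_cosets Exy lt_ga) ga_g).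
exists (k^-1 * h); last by rewrite mulVKg.
by have := PM Exy (PV Exy Pk) Pga; rewrite mulKg /ce_K Dal.
Qed.

Lemma relsRE r : relsRe r <-> exists x y a, E x y /\ r = Q x y a.
Proof.
split=> [[x [y [al [Exy lt_al ->]]]]|[x [y [a [Exy ->]]]]].
  have [a al_a] := cosets_neq0 (normalH Exy) (ce_cosets Exy lt_al).
  by exists x, y, a; split=> //; apply: R_coset_rel.
have [al lt_al al_a] := ce_index a Exy.
by exists x, y, al; split=> //; rewrite (R_coset_rel Exy lt_al al_a).
Qed.

(** The set in the definition of the product consists of the c with [atom_mul a b c]. It is a union
    of cosets of H_xz, so it contains a coset as soon as it contains one representative. *)
Lemma otimesRE x y z al be a b p : E x y -> E y z ->
    (al < kappa e x y)%O -> (be < kappa e y z)%O ->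
    ce_H e x y al a -> ce_H e y z be b ->
  otimesRe x y z al be p <-> exists2 c, T x y z a b c & Q x z c p.
Proof.
move=> Exy Eyz lt_al lt_be al_a be_b; have Exz := Etrans Exy Eyz.
have Dal := cosetsE (normalH Exy) (ce_cosets Exy lt_al) al_a.
have Dbe := cosetsE (normalH Eyz) (ce_cosets Eyz lt_be) be_b.
have prodE c : (phi_preimg F x y (ce_Ke x y al \o* ce_H e y z be)
                  \o* C x y z) c <-> T x y z a b c.
  have preE g : phi_preimg F x y (ce_Ke x y al \o* ce_H e y z be) g <->
      exists2 q, (ce_Ke x y al \o* ce_H e y z be) q & P x y g q.
    rewrite Dbe /ce_K Dal; apply: (phi_preimgE _ Exy).
    (* For closure under H_yx, conjugation by b' moves k next to a', where K_(xy,alpha) absorbs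
       it. *)
    move=> _ k [a' Pa [b' bb' <-]] Hk; exists (a' * (b' * k * b'^-1)).
      apply/(P_eqr _ Exy Pa); rewrite /eqmod mulKg.
      by have := normalJ b'^-1 (normalH (Esym Exy)) Hk; rewrite invgK.
    by exists b' => //; rewrite ?gnorm.
  split=> [[g /preE [_ [a' Pa [b' bb' <-]] Pg] [u Cu <-]]|[b' [u [Pb Cu ->]]]].
    move: Pa bb'; rewrite Dbe /ce_K Dal => Pa /in_coset bb'.
    have: T x y z a b' (g * u).
      exists (a^-1 * g), u; split=> //; last by rewrite ?gnorm.
      by have := PM Exy (PV Exy Pa) Pg; rewrite mulKg.
    apply: atom_mul_eqmod => //; first exact: eqmodH_refl.
      exact: (@eqmod_sym _ _ (normalH Eyz) _ _ bb').
    exact: eqmodH_refl.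
  have [a' Pa] := P_total a Exy.
  exists (a * b'); last by exists u.
  apply/preE; exists (a' * b); last exact: PM.
  by exists a'; [rewrite /ce_K Dal|exists b].
split=> [[ga [lt_ga ga_sub] Rp]|[c Tc Qp]].
  have [c ga_c] := cosets_neq0 (normalH Exz) (ce_cosets Exz lt_ga).
  exists c; first exact/prodE/ga_sub.
  by rewrite -(R_coset_rel Exz lt_ga ga_c).
have [ga lt_ga ga_c] := ce_index c Exz; exists ga.
  split=> // c' ga_c'; apply/prodE; apply: atom_mul_eqmod Tc => //.
  - exact: eqmodH_refl.
  - exact: eqmodH_refl.
  - exact/(cosets_eqmod (normalH Exz) _ (ce_cosets Exz lt_ga)).
by rewrite (R_coset_rel Exz lt_ga ga_c).
Qed.

(** * Elements of the algebra as saturated sets *)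

Definition contains S x y (a : G x) := Q x y a `<=` S.
Local Notation M := (@contains).

Lemma otimesE S S' p : otimese S S' p <->
  exists x y z a b c, [/\ E x y, E y z, M S x y a, M S' y z b
                        & T x y z a b c /\ Q x z c p].
Proof.
split.
  case=> r [_ rS] [s [_ sS'] [x [y [z [al [be]]]]]].
  case=> -[Exy lt_al] [Eyz lt_be] Dr Ds.
  have [a al_a] := cosets_neq0 (normalH Exy) (ce_cosets Exy lt_al).
  have [b be_b] := cosets_neq0 (normalH Eyz) (ce_cosets Eyz lt_be).
  case/(otimesRE p Exy Eyz lt_al lt_be al_a be_b) => c Tc Qp.
  exists x, y, z, a, b, c; split=> //.
    by rewrite /contains -(R_coset_rel Exy lt_al al_a) -Dr.
  by rewrite /contains -(R_coset_rel Eyz lt_be be_b) -Ds.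
case=> x [y [z [a [b [c [Exy Eyz MS MS' [Tc Qp]]]]]]].
have [al lt_al al_a] := ce_index a Exy; have [be lt_be be_b] := ce_index b Eyz.
exists (Q x y a); first by split=> //; apply/relsRE; exists x, y, a.
exists (Q y z b); first by split=> //; apply/relsRE; exists y, z, b.
exists x, y, z, al, be; split=> //.
- by rewrite (R_coset_rel Exy lt_al al_a).
- by rewrite (R_coset_rel Eyz lt_be be_b).
- by apply/(otimesRE p Exy Eyz lt_al lt_be al_a be_b); exists c.
Qed.

(** Membership in the algebra without enumerations: a union of atoms is a subset of E that includes
    every atom it meets. *)
Definition saturated S := S `<=` unitE F /\
  forall x y a p q, E x y -> Q x y a p -> Q x y a q -> S p -> S q.

Lemma domAE S : domAe S <-> saturated S.
Proof.
split=> [[X XR ->]|[SE satS]].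
  split=> [p [r Xr rp]|x y a p q Exy Qp Qq [r Xr rp]].
    by move: (XR _ Xr) rp => /relsRE [x [y [a [Exy ->]]]];
      apply: coset_rel_unit.
  move: (XR _ Xr) (rp) => /relsRE [x' [y' [a' [Exy' Dr]]]].
  exists r => //; move: rp; rewrite Dr => /[dup] rp /(coset_rel_index Qp) [ex
    ey].
  subst x' y'; move: rp => /(coset_rel_eqmod _ Exy Qp) aa'.
  by rewrite -(coset_rel_eq Exy aa').
exists [set r | relsRe r /\ r `<=` S]; first by move=> r [].
apply/seteqP; split=> [p Sp|p [r [_ rS] /rS//]].
have [x [y [a [Exy Qp]]]] := coset_rel_cover (SE _ Sp).
exists (Q x y a) => //; split; first by apply/relsRE; exists x, y, a.
by move=> q Qq; apply: satS Qp Qq Sp.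
Qed.

Lemma contains_in S x y a p : saturated S -> E x y -> Q x y a p -> S p <-> M S
  x y a.
Proof.
by move=> [_ satS] Exy Qp; split=> [Sp q Qq|]; [apply: satS Qp Qq Sp|apply].
Qed.

(** The atoms cover E, so inclusions between elements can be checked on representatives of atoms. *)
Lemma saturated_sub S S' : saturated S -> saturated S' ->
  (forall x y a, E x y -> M S x y a -> M S' x y a) -> S `<=` S'.
Proof.
move=> satS satS' SS' p Sp; have [SE _] := satS.
have [x [y [a [Exy Qp]]]] := coset_rel_cover (SE _ Sp).
exact/(contains_in satS' Exy Qp)/SS'/(contains_in satS Exy Qp).
Qed.

Lemma saturated_eq S S' : saturated S -> saturated S' ->
  (forall x y a, E x y -> M S x y a <-> M S' x y a) -> S = S'.
Proof.
by move=> sS sS' SS'; apply/seteqP; split; apply: saturated_sub => // x y a Exy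
  /(SS' _ _ _ Exy).
Qed.

Lemma contains_eqmod S x y a b : E x y -> eqmod (H x y) a b -> M S x y a -> M S
  x y b.
Proof. by move=> Exy ab; rewrite /contains (coset_rel_eq Exy ab). Qed.

Lemma contains_coset_rel x y a x' y' b : E x y -> M (Q x' y' b) x y a -> x = x'
  /\ y = y'.
Proof. by move=> Exy QQ; have [p Qp] := coset_rel_neq0 a Exy;
  exact: (coset_rel_index Qp (QQ _ Qp)). Qed.

Lemma saturated_coset_rel x y a : E x y -> saturated (Q x y a).
Proof.
move=> Exy; split; first exact: coset_rel_unit.
move=> x' y' a' p q _ Qp Qq Qp'; have [ex ey] := coset_rel_index Qp' Qp;
  subst x' y'.
by apply/(coset_rel_eqmod _ Exy Qq); apply/(coset_rel_eqmod _ Exy Qp).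
Qed.

Lemma saturatedU S S' : saturated S -> saturated S' -> saturated (S `|` S').
Proof.
move=> [SE satS] [SE' satS']; split; first by rewrite subUset.
move=> x y a p q Exy Qp Qq [Sp|Sp]; first by left; apply: satS Qp Qq Sp.
by right; apply: satS' Qp Qq Sp.
Qed.

Lemma saturatedC S : saturated S -> saturated (unitE F `\` S).
Proof.
move=> [SE satS]; split=> [p []//|x y a p q Exy Qp Qq [_ nSp]].
by split; [apply: coset_rel_unit Qq|move=> /(satS _ _ _ _ _ Exy Qq Qp)].
Qed.

Lemma saturated_bigcup (X : set (set (V * V))) :
  (forall S, X S -> saturated S) -> saturated (\bigcup_(S in X) S).
Proof.
move=> satX; split=> [p [S XS Sp]|x y a p q Exy Qp Qq [S XS Sp]].
  by have [SE _] := satX _ XS; apply: SE.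
by exists S => //; have [_ satS] := satX _ XS; apply: satS Qp Qq Sp.
Qed.

Lemma saturated_otimes S S' : saturated (otimese S S').
Proof.
split=> [p /otimesE|x y a p q Exy Qp Qq /otimesE].
  case=> x [y [z [a [b [c [Exy Eyz _ _ [_]]]]]]]; apply: coset_rel_unit.
  exact: Etrans Eyz.
case=> x' [y' [z' [a' [b [c [Exy' Eyz MS MS' [Tc Qp']]]]]]]; apply/otimesE.
have [ex ez] := coset_rel_index Qp Qp'; subst x' z'.
exists x, y', y, a', b, c; split=> //; split=> //.
by apply/(coset_rel_eqmod _ Exy Qq); apply/(coset_rel_eqmod _ Exy Qp).
Qed.

Definition conv S : set (V * V) := [set p | S (p.2, p.1)].

Lemma unit_swap p : unitE F p -> unitE F (p.2, p.1).
Proof. by case=> -[x y] /= Exy []; exists (y, x) => //=; apply: Esym. Qed.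

Lemma saturated_conv S : saturated S -> saturated (conv S).
Proof.
move=> [SE satS]; split=> [[u v] /SE/unit_swap//|x y a p q Exy Qp Qq].
have [b Pb] := P_total a^-1 Exy.
exact: satS (Esym Exy) (coset_rel_swap Exy Pb Qp) (coset_rel_swap Exy Pb Qq).
Qed.

Definition idU : set (V * V) := [set p | base F p.1 /\ p.1 = p.2].

Lemma idUE p : idU p <-> exists x, Q x x 1 p.
Proof.
split=> [|[x [g [h [-> /Pxx]]]]].
  case: p => u v [[x _ [g _ /= <-]] <-]; exists x; apply/coset_relE;
    rewrite mulg1.
  exact/Pxx.
rewrite mulg1 => -> //; split=> //; exists x => //; by exists h.
Qed.

Lemma saturated_id : saturated idU.
Proof.
rewrite (_ : idU = \bigcup_(S in [set Q x x 1 | x in setT]) S).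
  by apply: saturated_bigcup => _ [x _ <-]; apply: saturated_coset_rel.
apply/seteqP; split=> p; first by case/idUE => x Qp; exists (Q x x 1) => //;
  exists x.
by case=> _ [x _ <-] Qp; apply/idUE; exists x.
Qed.

(** * Atoms below sums, complements, products and converses *)

Lemma containsU S S' x y a : saturated S -> saturated S' -> E x y ->
  M (S `|` S') x y a <-> M S x y a \/ M S' x y a.
Proof.
move=> satS satS' Exy; have [p Qp] := coset_rel_neq0 a Exy.
by rewrite -!(contains_in _ Exy Qp) //; apply: saturatedU.
Qed.

Lemma containsC S x y a : saturated S -> E x y ->
  M (unitE F `\` S) x y a <-> ~ M S x y a.
Proof.
move=> satS Exy; have [p Qp] := coset_rel_neq0 a Exy.
rewrite -!(contains_in _ Exy Qp) //; last exact: saturatedC.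
by split=> [[]//|]; split=> //; apply: coset_rel_unit Qp.
Qed.

Lemma contains_otimes S S' x z c : E x z -> M (otimese S S') x z c <->
  exists y a b, [/\ E x y, E y z, M S x y a, M S' y z b & T x y z a b c].
Proof.
move=> Exz; have [p Qp] := coset_rel_neq0 c Exz.
rewrite -(contains_in (saturated_otimes _ _) Exz Qp) otimesE; split.
  case=> x' [y [z' [a [b [c' [Exy Eyz MS MS' [Tc Qp']]]]]]].
  have [ex ez] := coset_rel_index Qp Qp'; subst x' z'.
  exists y, a, b; split=> //; apply: atom_mul_eqmod Tc => //;
    try exact: eqmodH_refl.
  exact/(coset_rel_eqmod _ Exz Qp').
by case=> y [a [b [Exy Eyz MS MS' Tc]]]; exists x, y, z, a, b, c.
Qed.

Lemma contains_conv S x y a b : saturated S -> E x y -> P x y a^-1 b ->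
  M (conv S) x y a <-> M S y x b.
Proof.
move=> satS Exy Pab; have [p Qp] := coset_rel_neq0 a Exy.
rewrite -(contains_in (saturated_conv satS) Exy Qp).
exact: contains_in (Esym Exy) (coset_rel_swap Exy Pab Qp).
Qed.

Lemma contains_id_index x y a : E x y -> M idU x y a -> x = y.
Proof.
move=> Exy idQ; have [p Qp] := coset_rel_neq0 a Exy.
by have /idUE [x' /(coset_rel_index Qp) [-> ->]] := idQ _ Qp.
Qed.

Lemma Hxx_eqmod x (a b : G x) : eqmod (H x x) a b <-> a = b.
Proof.
rewrite Hxx /eqmod /=; split=> [ab|->]; last by rewrite mulVg.
by rewrite -[b](mulVKg a) ab mulg1.
Qed.

Lemma contains_coset_relxx x (a b : G x) : M (Q x x b) x x a <-> a = b.
Proof.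
split=> [QQ|->//]; have [p Qp] := coset_rel_neq0 a (Exx x).
exact/Hxx_eqmod/(coset_rel_eqmod _ (Exx x) Qp)/QQ.
Qed.

Lemma contains_id x (a : G x) : M idU x x a <-> a = 1.
Proof.
rewrite -contains_coset_relxx; split=> [idQ|QQ p /QQ Qp]; last by apply/idUE;
  exists x.
have [p Qp] := coset_rel_neq0 a (Exx x).
have /idUE [x' Qp'] := idQ _ Qp; have [ex _] := coset_rel_index Qp Qp';
  subst x'.
exact/(contains_in (saturated_coset_rel _ (Exx x)) (Exx x) Qp).
Qed.

(** * The relation algebra axioms *)

Local Notation CF := (coset_algebra e).

Lemma domCF S : ra_dom CF S <-> saturated S.
Proof. exact: domAE. Qed.

Lemma leCF S S' : ra_le CF S S' <-> S `<=` S'.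
Proof. exact: setUidPr. Qed.

Lemma oneCF : ra_one CF = unitE F.
Proof. by have [idE _] := saturated_id; apply: setDUK. Qed.

Lemma zeroCF : ra_zero CF = set0.
Proof. by rewrite /ra_zero oneCF /= setDv. Qed.

Lemma nonzeroCF S : S <> ra_zero CF -> exists p, S p.
Proof. by rewrite zeroCF => /eqP/set0P. Qed.

Lemma huntingtonCF S S' : saturated S ->
  (unitE F `\` ((unitE F `\` S) `|` S')) `|`
    (unitE F `\` ((unitE F `\` S) `|` (unitE F `\` S'))) = S.
Proof.
move=> [SE _]; apply/seteqP; split=> [p [[Ep nS]|[Ep nS]]|p Sp].
- by apply: contrapT => nSp; apply: nS; left.
- by apply: contrapT => nSp; apply: nS; left.
have Ep := SE _ Sp; have [S'p|nS'p] := EM (S' p).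
  by right; split=> // -[[]|[]].
by left; split=> // -[[]|].
Qed.

Lemma otimesA S1 S2 S3 : ra_mul CF S1 (ra_mul CF S2 S3) = ra_mul CF (ra_mul CF
  S1 S2) S3.
Proof.
apply: saturated_eq; try exact: saturated_otimes.
move=> x w g Exw; rewrite /= !contains_otimes //; split.
  case=> y [a [t [Exy Eyw M1 /(contains_otimes _ _ _ Eyw) [z [b [c [Eyz Ezw M2
    M3 Tt]]]] Tg]]].
  have [s Ts Tg'] := atom_mul_assocl Exy Eyz Ezw Tt Tg;
    have Exz := Etrans Exy Eyz.
  exists z, s, c; split=> //; apply/contains_otimes => //.
  by exists y, a, b.
case=> z [s [c [Exz Ezw /(contains_otimes _ _ _ Exz) [y [a [b [Exy Eyz M1 M2
  Ts]]]] M3 Tg]]].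
have [t Tt Tg'] := atom_mul_assocr Exy Eyz Ezw Ts Tg;
  have Eyw := Etrans Eyz Ezw.
exists y, a, t; split=> //; apply/contains_otimes => //.
by exists z, b, c.
Qed.

Lemma otimes1 S : saturated S -> ra_mul CF S (ra_id CF) = S.
Proof.
move=> satS; apply: saturated_eq => //; first exact: saturated_otimes.
move=> x y c Exy; rewrite contains_otimes //; split.
  case=> z [a [b [Exz Ezy MS Mid Tc]]].
  have ez := contains_id_index Ezy Mid; subst z.
  move: Mid Tc => /contains_id -> /(atom_mulr1 _ _ Exy) ac.
  exact: contains_eqmod ac MS.
move=> MS; exists y, c, 1; split=> //; first exact/contains_id.
by apply/atom_mulr1 => //; apply: eqmodH_refl.
Qed.

Lemma conv_otimes_sub S S' : saturated S -> saturated S' ->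
  conv (ra_mul CF S S') `<=` ra_mul CF (conv S') (conv S).
Proof.
move=> satS satS'; apply: saturated_sub.
- exact/saturated_conv/saturated_otimes.
- exact: saturated_otimes.
move=> z x c' Ezx; have Exz := Esym Ezx.
have [c Pc] := P_total c'^-1 Ezx.
move=> /(contains_conv (saturated_otimes _ _) Ezx Pc) /(contains_otimes _ _ _
  Exz).
case=> y [a [b [Exy Eyz MS MS' Tc]]].
have [a' Pa] := P_total a^-1 Exy; have [b' Pb] := P_total b^-1 Eyz.
apply/contains_otimes => //; exists y, b', a'; split; try exact: Esym.
- apply/(contains_conv satS' (Esym Eyz) (b := b)) => //.
  by have := PV (Esym Eyz) (P_sym Eyz Pb); rewrite invgK.
- apply/(contains_conv satS (Esym Exy) (b := a)) => //.
  by have := PV (Esym Exy) (P_sym Exy Pa); rewrite invgK.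
apply: atom_mul_conv Pa Pb _ Tc => //.
by have := PV Exz (P_sym Ezx Pc); rewrite invgK.
Qed.

Lemma conv_otimes S S' : saturated S -> saturated S' ->
  conv (ra_mul CF S S') = ra_mul CF (conv S') (conv S).
Proof.
have convK S0 : conv (conv S0) = S0 by apply/seteqP; split=> -[].
move=> satS satS'; apply/seteqP; split; first exact: conv_otimes_sub.
(* The reverse inclusion is the first one for the converses, since [conv] is an involution. *)
have := conv_otimes_sub (saturated_conv satS') (saturated_conv satS).
by rewrite !convK => sub [u v] /(sub (v, u)).
Qed.

Lemma otimesDl S1 S2 S3 : saturated S1 -> saturated S2 ->
  ra_mul CF (S1 `|` S2) S3 = ra_mul CF S1 S3 `|` ra_mul CF S2 S3.
Proof.
move=> sat1 sat2; apply: saturated_eq; first exact: saturated_otimes.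
  by apply: saturatedU; apply: saturated_otimes.
move=> x z c Exz; rewrite containsU ?contains_otimes //;
  try exact: saturated_otimes.
split=> [[y [a [b [Exy Eyz /(containsU _ sat1 sat2 Exy) [M1|M2] M3 Tc]]]]|].
- by left; exists y, a, b.
- by right; exists y, a, b.
by case=> -[y [a [b [Exy Eyz MS M3 Tc]]]]; exists y, a, b; split=> //;
  apply/containsU => //; [left|right].
Qed.

(** If an atom b of S' lay in the product, witnessed by an atom c outside S;S', then
    [atom_mul_peirce] would place c below S;S'. *)
Lemma otimes_tarski S S' : saturated S -> saturated S' ->
  ra_mul CF (conv S) (unitE F `\` ra_mul CF S S') `<=` unitE F `\` S'.
Proof.
move=> satS satS'; apply: saturated_sub; first exact: saturated_otimes.
  exact: saturatedC.
move=> y z b Eyz /(contains_otimes _ _ _ Eyz) [x [a' [c [Eyx Exz Ma Mc Tb]]]].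
apply/containsC => // MS'; move: Mc => /(containsC _ (saturated_otimes _ _)
  Exz); apply.
have [a Pa] := P_total a'^-1 Eyx; apply/contains_otimes => //; exists y, a, b;
  split=> //.
  exact: Esym.
  exact/(contains_conv satS Eyx Pa).
exact: atom_mul_peirce Tb.
Qed.

Lemma relation_algebraCF : relation_algebra CF.
Proof.
split=> /=.
- by move=> S S' /domCF satS /domCF satS'; apply/domCF/saturatedU.
- by move=> S /domCF satS; apply/domCF/saturatedC.
- by move=> S S' _ _; apply/domCF/saturated_otimes.
- by move=> S /domCF satS; apply/domCF/saturated_conv.
- exact/domCF/saturated_id.
- by move=> S S' _ _; apply: setUC.
- by move=> S1 S2 S3 _ _ _; apply: setUA.
- by move=> S S' /domCF satS _; apply: huntingtonCF.
- by move=> S1 S2 S3 _ _ _; apply: otimesA.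
- by move=> S /domCF; apply: otimes1.
- by move=> S _; apply/seteqP; split=> -[].
- by move=> S S' /domCF satS /domCF satS'; apply: conv_otimes.
- by move=> S1 S2 S3 /domCF sat1 /domCF sat2 _; apply: otimesDl.
- by [].
- by move=> S S' /domCF satS /domCF satS'; apply/setUidPr/otimes_tarski.
Qed.

(** * Completeness, atoms and measurability *)

Lemma ra_sum_bigcup X : X `<=` ra_dom CF -> ra_sum CF X (\bigcup_(S in X) S).
Proof.
move=> domX; split=> //.
- by apply/domCF/saturated_bigcup => S /domX /domCF.
- by move=> S XS; apply/leCF => p Sp; exists S.
- by move=> S _ leS; apply/leCF => p [S' /leS /leCF S'S]; apply: S'S.
Qed.

Lemma atom_coset_rel (S : set (V * V)) : ra_atom CF S <-> exists x y a, E x y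
  /\ S = Q x y a.
Proof.
split=> [[/domCF satS S0 minS]|[x [y [a [Exy ->]]]]].
  have [p Sp] := nonzeroCF S0.
  have [x [y [a [Exy Qp]]]] := coset_rel_cover (satS.1 _ Sp).
  exists x, y, a; split=> //.
  have [||Q0|//] := minS (Q x y a); first exact/domCF/saturated_coset_rel.
    exact/leCF/(contains_in satS Exy Qp).
  by move: Qp; rewrite Q0 zeroCF.
have satQ := saturated_coset_rel a Exy; split; first exact/domCF.
  by have [p Qp] := coset_rel_neq0 a Exy => Q0; move: Qp; rewrite Q0 zeroCF.
move=> S' /domCF satS' /leCF SQ; rewrite zeroCF.
have [|/forallNP nS] := EM (exists p, S' p).
  case=> p Sp; right; apply/seteqP; split=> //.
  exact/(contains_in satS' Exy (SQ _ Sp)).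
by left; apply/seteqP; split.
Qed.

Lemma atomicCF : ra_atomic CF.
Proof.
move=> S /domCF satS S0.
have [p Sp] := nonzeroCF S0.
have [x [y [a [Exy Qp]]]] := coset_rel_cover (satS.1 _ Sp).
exists (Q x y a); first by apply/atom_coset_rel; exists x, y, a.
exact/leCF/(contains_in satS Exy Qp).
Qed.

Lemma R_bot x : R e x x \bot%O = Q x x 1.
Proof.
(* Some index lies below kappa_xx because the coset of 1 is enumerated; hence so does the least
   index. *)
have [al lt_al _] := ce_index (1 : G x) (Exx x).
apply: R_coset_rel => //; first exact: Order.POrderTheory.le_lt_trans
  (Order.BPreorderTheory.le0x al) lt_al.
by rewrite ce_0 // Hxx.
Qed.

Lemma subid_atom_coset_rel S : ra_subid_atom CF S <-> exists x, S = Q x x 1.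
Proof.
split=> [[/atom_coset_rel [x [y [a [Exy ->]]]] /leCF idQ]|[x ->]].
  have ey := contains_id_index Exy idQ; subst y; exists x.
  by move: idQ => /contains_id ->.
split; first by apply/atom_coset_rel; exists x, x, 1.
exact/leCF/contains_id.
Qed.

(** Exhibits the square on G_x as a union of atoms indexed by G_x, each of which will be shown to be
    functional. *)
Lemma square_id x :
  ra_mul CF (ra_mul CF (Q x x 1) (ra_one CF)) (Q x x 1)
    = \bigcup_(S in range (Q x x)) S.
Proof.
rewrite oneCF; apply: saturated_eq; first exact: saturated_otimes.
  by apply: saturated_bigcup => _ [a _ <-]; apply: saturated_coset_rel.
move=> y z c Eyz; rewrite contains_otimes //; split.
  case=> w [s [b [Eyw Ewz /(contains_otimes _ _ _ Eyw) [v [a [t [Eyv _ + _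
    _]]]] + _]]].
  move=> /(contains_coset_rel Eyv) [ey _] /(contains_coset_rel Ewz) [_ ez];
    subst y z.
  by move=> p Qp; exists (Q x x c) => //; exists c.
move=> Mc; have [p Qp] := coset_rel_neq0 c Eyz; have [_ [a _ <-] Qa] := Mc _ Qp.
have [ey ez] := coset_rel_index Qp Qa; subst y z.
exists x, c, 1; split=> //; last by apply/atom_mulxx; rewrite mulg1.
apply/contains_otimes => //; exists x, 1, c; split=> //;
  first exact: coset_rel_unit.
by apply/atom_mulxx; rewrite mul1g.
Qed.

(** By [atom_mulxx] the converse followed by the relation is the atom of a^-1 a = 1. *)
Lemma functional_coset_rel x (a : G x) : ra_functional CF (Q x x a).
Proof.
have satQ := saturated_coset_rel a (Exx x).
split; first exact/domCF.
apply/leCF; apply: saturated_sub;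
  [exact: saturated_otimes|exact: saturated_id|].
move=> y z c Eyz /(contains_otimes _ _ _ Eyz) [w [b [b' [Eyw Ewz Mb Mb' Tc]]]].
have [ew ez] := contains_coset_rel Ewz Mb'; subst w z.
have [g Pg] := P_total b^-1 Eyw.
move: Mb => /(contains_conv satQ Eyw Pg) Mg.
have [_ ey] := contains_coset_rel (Esym Eyw) Mg; subst y.
move: Mg Mb' Pg Tc => /contains_coset_relxx -> /contains_coset_relxx -> /Pxx <-
  /atom_mulxx ->.
by apply/contains_id; rewrite mulgV.
Qed.

Lemma measurable_atom_coset_rel x : ra_measurable_atom CF (Q x x 1).
Proof.
split; first by apply/subid_atom_coset_rel; exists x.
exists (range (Q x x)); first by move=> _ [a _ <-]; apply: functional_coset_rel.
rewrite square_id; apply: ra_sum_bigcup => _ [a _ <-].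
exact/domCF/saturated_coset_rel.
Qed.

Lemma measurableCF : ra_measurable CF.
Proof.
exists [set Q x x 1 | x in setT]; first by move=> _ [x _ <-];
  apply: measurable_atom_coset_rel.
rewrite (_ : ra_id CF = \bigcup_(S in [set Q x x 1 | x in setT]) S).
  by apply: ra_sum_bigcup => _ [x _ <-]; apply/domCF/saturated_coset_rel.
apply/seteqP; split=> [p /idUE [x Qp]|p [_ [x _ <-] Qp]].
  by exists (Q x x 1) => //; exists x.
by apply/idUE; exists x.
Qed.

Lemma measure_set_range x : ra_measure_set CF (Q x x 1) = range (Q x x).
Proof.
apply/seteqP; split=> [S [[/domCF satS /leCF fS] S0]|_ [a _ <-]].
  rewrite square_id => /leCF SQ.
  have [p Sp] := nonzeroCF S0.
  have [_ [a _ <-] Qp] := SQ _ Sp; exists a => //.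
  have MSa := (contains_in satS (Exx x) Qp).1 Sp.
  apply/seteqP; split=> // q Sq; have [_ [b _ <-] Qq] := SQ _ Sq.
  have MSb := (contains_in satS (Exx x) Qq).1 Sq.
  (* If a functional S contains the atoms of a and b, its converse times S contains that of a^-1 b,
     which must be the identity; so S is a single atom. *)
  suff: M (ra_id CF) x x (a^-1 * b).
    by move=> /contains_id ab; move: Qq; rewrite -[b](mulVKg a) ab mulg1.
  move=> q' Qq'; apply: fS; move: q' Qq'; apply/contains_otimes => //.
  exists x, a^-1, b; split=> //; last exact/atom_mulxx.
  by apply/(contains_conv satS (Exx x) (b := a)) => //; apply/Pxx;
    rewrite invgK.
split; first exact: functional_coset_rel.
  by have [p Qp] := coset_rel_neq0 a (Exx x) => Q0; move: Qp; rewrite Q0 zeroCF.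
by rewrite square_id; apply/leCF => p Qp; exists (Q x x a) => //; exists a.
Qed.

(** Since H_xx is trivial, distinct elements of G_x give distinct atoms. *)
Lemma card_measure_set x : (ra_measure_set CF (Q x x 1) #= [set: G x])%card.
Proof.
rewrite measure_set_range; apply: inj_card_eq => a b _ _ Qab.
by apply/contains_coset_relxx; rewrite /contains Qab.
Qed.

(** * Base set and atoms in terms of the enumerations *)

Lemma domCF_base S : ra_dom CF S -> S `<=` base F `*` base F.
Proof.
move=> /domCF [SE _] p /SE [[x y] _ /= [[g _ eg] [h _ eh]]].
by split; [exists x => //; exists g|exists y => //; exists h].
Qed.

Lemma atomsCF : ra_atom CF =
  [set S | exists x y a, [/\ E x y, (a < kappa e x y)%O & S = R e x y a]].
Proof. by apply/seteqP; split=> S; rewrite /= atom_coset_rel -relsRE. Qed.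

Lemma subid_atomsCF : ra_subid_atom CF = [set R e x x \bot%O | x in [set: I]].
Proof.
apply/seteqP; split=> [S /subid_atom_coset_rel [x ->]|_ [x _ <-]].
  by exists x => //; apply: R_bot.
by apply/subid_atom_coset_rel; exists x; apply: R_bot.
Qed.

End CosetAlgebra.

Local Close Scope group_scope.
Local Open Scope card_scope.

Theorem theorem4p2 (I : Type) (E : I -> I -> Prop) (eqE : Equivalence E)
    (F : group_triple E) (sfF : semi_frame F) (ccF : coset_conditions F)
    (d : Order.disp_t) (Ord : bOrderType d)
    (woOrd : well_order (<=%O : rel Ord)) (e : coset_enumeration F Ord) :
  let CF := coset_algebra e in
  [/\ [/\ relation_algebra CF, ra_complete CF, ra_atomic CF & ra_measurable CF],
      (forall S, ra_dom CF S -> S `<=` base F `*` base F) /\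
        ra_one CF = unitE F,
      ra_atom CF =
        [set S | exists x y a,
           [/\ E x y, (a < kappa e x y)%O & S = R e x y a]],
      ra_subid_atom CF = [set R e x x \bot%O | x in [set: I]]
    & forall x : I,
        ra_measure_set CF (R e x x \bot%O) #= [set: gt_G F x]].
Proof.
move=> CF; split; first split.
- exact: relation_algebraCF.
- by move=> X domX; exists (\bigcup_(S in X) S); apply: ra_sum_bigcup.
- exact: atomicCF.
- exact: measurableCF.
- by split; [exact: domCF_base|exact: oneCF].
- exact: atomsCF.
- exact: subid_atomsCF.
- by move=> x; rewrite R_bot //; apply: card_measure_set.
Qed.
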